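(* Let $\Gamma$ be a progressive, polarized and anchored graph. Then there exists at most one planar structure $\prec$ on $\Gamma$ compatible with these structures, i.e. such that: (i) $e_1\to e_2$ implies $e_1\prec e_2$ for any distinct edges $e_1,e_2$; (ii) for any vertex $v$: for $i_1,i_2\in In(v)$, $i_1<i_2$ if and only if $\overline{i_1}\prec\overline{i_2}$, and for $o_1,o_2\in Out(v)$, $o_1<o_2$ if and only if $\overline{o_1}\prec\overline{o_2}$; (iii) for $i_1,i_2\in In(\Gamma)$, $i_1<i_2$ if and only if $\overline{i_1}\prec\overline{i_2}$, and for $o_1,o_2\in Out(\Gamma)$, $o_1<o_2$ if and only if $\overline{o_1}\prec\overline{o_2}$.
   Context: A graph is a triple $(H,P,\sigma)$ with $H$ a finite set (half-edges), $P$ a partition of $H$ into nonempty blocks (vertices), $\sigma$ an involution of $H$ (its orbits are the edges), such that a vertex containing a two-element $\sigma$-orbit equals that orbit; such vertices and edges are called virtual. $\overline h$ denotes the edge containing the half-edge $h$. A leg is a half-edge that is fixed by $\sigma$ or lies in a virtual edge. An orientation $\mathrm{sgn}:H\to\{+,-\}$ takes different values on the two elements of each two-element orbit; $In(v),Out(v)$ (resp. $In(\Gamma),Out(\Gamma)$) are the sets of half-edges in $v$ (resp. of legs) of sign $+$, $-$. An oriented graph is directed if all $In(v),Out(v)$ are nonempty. The source (target) of an edge is the vertex containing its $-$ ($+$) half-edge, if there is one; a directed path is a sequence of edges $e_1,\dots,e_n$, $n\ge1$, with the target of $e_i$ equal to the source of $e_{i+1}$; $e\to e'$ means there is a directed path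 starting with the edge $e$ and ending with the edge $e'$. A directed graph is progressive if it is acyclic, i.e. has no directed path whose starting vertex equals its ending vertex (virtual edges, which form separate components representing isolated strands, are not counted as circuits). It is polarized if each $In(v)$ and each $Out(v)$ is equipped with a linear order $<$, and anchored if $In(\Gamma)$ and $Out(\Gamma)$ are equipped with linear orders $<$. A planar structure on a directed graph is a linear order $\prec$ on its set of edges such that for distinct edges: $(P_1)$ $e_1\to e_2$ implies $e_1\prec e_2$; $(P_2)$ if $e_1\to e_2$ and $e_1\prec e_3\prec e_2$, then $e_3\to e_2$ or $e_1\to e_3$. *)

(* Defs.v *)
From HB Require Import structures.
From mathcomp Require Import all_boot.
Set Implicit Arguments.
Unset Strict Implicit.
Unset Printing Implicit Defensive.

Definition strict_linear_on (T : finType) (A : {set T}) (r : rel T) : Prop :=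
  [/\ {in A, irreflexive r},
      {in A & &, transitive r} &
      {in A &, forall x y, x != y -> r x y || r y x}].

Record graph := Graph {
  half_edge : finType;
  vertices : {set {set half_edge}};
  invol : half_edge -> half_edge;
  vertices_partition : partition vertices [set: half_edge];
  invol_involutive : involutive invol;
  virtual_vertex : forall (v : {set half_edge}) (h : half_edge),
    v \in vertices -> invol h != h -> [set h; invol h] \subset v ->
    v = [set h; invol h]
}.

Record oriented_graph := OrientedGraph {
  ograph :> graph;
  sgn : half_edge ograph -> bool; (* true encodes +, false encodes - *)
  sgn_invol : forall h, invol h != h -> sgn (invol h) != sgn h
}.

(* As invol is an involution, [set h; invol h] is the orbit of h. *)
Definition edge_set (G : graph) : {set {set half_edge G}} :=
  [set [set h; invol h] | h in [set: half_edge G]].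

Record edge (G : graph) := Edge {
  edge_halves :> {set half_edge G};
  edge_halvesP : edge_halves \in edge_set G
}.
HB.instance Definition _ (G : graph) := [isSub for @edge_halves G].
HB.instance Definition _ (G : graph) := [Finite of edge G by <:].

Definition edge_of (G : graph) (h : half_edge G) : edge G :=
  Edge (imset_f (fun h => [set h; invol h]) (in_setT h)).

Definition is_virtual (G : graph) (e : edge G) : bool :=
  (#|e| == 2) && (edge_halves e \in vertices G).

Definition leg (G : graph) (h : half_edge G) : bool :=
  (invol h == h) || is_virtual (edge_of h).

Section Oriented.
Variable G : oriented_graph.
Implicit Types (v : {set half_edge G}) (e : edge G).

Definition In_v v : {set half_edge G} := [set h in v | sgn h].
Definition Out_v v : {set half_edge G} := [set h in v | ~~ sgn h].

Definition In_G : {set half_edge G} := [set h | leg h && sgn h].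
Definition Out_G : {set half_edge G} := [set h | leg h && ~~ sgn h].

Definition directed : Prop :=
  forall v, v \in vertices G -> In_v v != set0 /\ Out_v v != set0.

Definition is_source e v : bool :=
  (v \in vertices G) && [exists h in edge_halves e, (h \in v) && ~~ sgn h].
Definition is_target e v : bool :=
  (v \in vertices G) && [exists h in edge_halves e, (h \in v) && sgn h].

Definition consecutive e e' : bool := [exists v, is_target e v && is_source e' v].

(* A directed path e_1, ..., e_n with n >= 1 is given by its first edge and
   the sequence of the remaining ones. *)
Definition directed_path e (s : seq (edge G)) : bool := path consecutive e s.

Definition leads_to e e' : Prop :=
  exists2 s, directed_path e s & last e s = e'.

(* A virtual edge has its own vertex as source and target, so that its
   repetitions are the circuits to be disregarded. *)
Definition acyclic : Prop :=
  forall e s v, directed_path e s -> is_source e v -> is_target (last e s) v ->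
  all (@is_virtual G) (e :: s).

Definition progressive : Prop := directed /\ acyclic.

Record polarization := Polarization {
  lt_in : {set half_edge G} -> rel (half_edge G);
  lt_out : {set half_edge G} -> rel (half_edge G);
  lt_in_linear : forall v, v \in vertices G -> strict_linear_on (In_v v) (lt_in v);
  lt_out_linear : forall v, v \in vertices G -> strict_linear_on (Out_v v) (lt_out v)
}.

Record anchoring := Anchoring {
  lt_In : rel (half_edge G);
  lt_Out : rel (half_edge G);
  lt_In_linear : strict_linear_on In_G lt_In;
  lt_Out_linear : strict_linear_on Out_G lt_Out
}.

Record planar_structure (prec : rel (edge G)) : Prop := PlanarStructure {
  planar_linear : strict_linear_on [set: edge G] prec;
  planar_P1 : forall e1 e2, e1 != e2 -> leads_to e1 e2 -> prec e1 e2;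
  planar_P2 : forall e1 e2 e3, leads_to e1 e2 -> prec e1 e3 -> prec e3 e2 ->
    leads_to e3 e2 \/ leads_to e1 e3
}.

Record compatible (pol : polarization) (anc : anchoring) (prec : rel (edge G)) :
    Prop := Compatible {
  compatible_path : forall e1 e2, e1 != e2 -> leads_to e1 e2 -> prec e1 e2;
  compatible_in : forall v, v \in vertices G -> {in In_v v &, forall i1 i2,
    lt_in pol v i1 i2 <-> prec (edge_of i1) (edge_of i2)};
  compatible_out : forall v, v \in vertices G -> {in Out_v v &, forall o1 o2,
    lt_out pol v o1 o2 <-> prec (edge_of o1) (edge_of o2)};
  compatible_In : {in In_G &, forall i1 i2,
    lt_In anc i1 i2 <-> prec (edge_of i1) (edge_of i2)};
  compatible_Out : {in Out_G &, forall o1 o2,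
    lt_Out anc o1 o2 <-> prec (edge_of o1) (edge_of o2)}
}.

End Oriented.

(* Main.v *)
Require Import Defs.
From mathcomp Require Import all_boot.

(** Fix a compatible planar structure and write [->] for reachability.  Edges
    related by [->] are ordered as (P_1) dictates, so only incomparable edges
    [e1], [e2] matter.  For these the proof finds ancestors [o1 -> e1] and
    [o2 -> e2] that are separated, i.e. [o1] does not lead to [e2] nor [o2] to
    [e1], and whose relative order is prescribed by the extra structure on the
    graph.  By (P_2) separated ancestors are ordered in the same way as their
    descendants ([prec_separated_ancestors]), hence the order of [e1] and [e2]
    is prescribed too.

    The separated ancestors ([separated_ancestors]) arise in one of two ways.
    If [e1] and [e2] have a common ancestor, take a lowest one, [x]: the paths
    from [x] to [e1] and to [e2] leave the target of [x] through two outgoing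
    half-edges, which the polarization compares, and neither of their edges is
    again a common ancestor.  If there is no common ancestor, then input edges
    above [e1] and [e2] ([input_ancestor]) are automatically separated, and the
    anchoring compares them.

    Since (P_1) embeds [->] into a strict order, [->] is antisymmetric; this is
    what makes lowest and highest edges exist. *)

Set Implicit Arguments.
Unset Strict Implicit.
Unset Printing Implicit Defensive.

Lemma exists_maximal (T : finType) (R : rel T) (P : pred T) (x0 : T) :
  reflexive R -> transitive R -> antisymmetric R -> P x0 ->
  exists2 x, P x & forall y, P y -> R x y -> y = x.
Proof.
move=> Rxx Rtr Ranti Px0; pose up x := #|[set y | R x y]|.
case: (arg_minnP up Px0) => x Px minx; exists x => // y Py Rxy.
apply/eqP; apply: contraT => neq_yx.
have: up y < up x; last by rewrite ltnNge minx.
apply/proper_card/properP; split.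
  by apply/subsetP => z; rewrite !inE; apply: Rtr.
exists x; rewrite !inE //; apply: contra neq_yx => Ryx.
by apply/eqP/Ranti; rewrite Ryx.
Qed.

(** The second vertex of a nontrivial path can be chosen different from the
    first even if the relation has loops; here virtual edges are loops. *)
Lemma connect_first_step (T : finType) (R : rel T) (x y : T) :
  connect R x y -> x != y -> exists z, [/\ R x z, z != x & connect R z y].
Proof.
case/connectP => p xp ->; case/shortenP: xp => -[|z q] /=.
  by rewrite eqxx.
case/andP=> Rxz zq /andP[]; rewrite inE negb_or eq_sym => /andP[nzx _] _ _ _.
by exists z; split=> //; apply/connectP; exists q.
Qed.

(** * Half-edges and edges of an oriented graph *)

Section Edges.
Variable G : oriented_graph.
Implicit Types (h k : half_edge G) (e : edge G) (v : {set half_edge G}).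

Lemma mem_edge_of h : h \in edge_halves (edge_of h).
Proof. by rewrite !inE eqxx. Qed.

Lemma edge_of_mem h e : h \in edge_halves e -> edge_of h = e.
Proof.
case: e => E EP /= hE; apply/val_inj => /=.
case/imsetP: EP hE => k _ ->; rewrite !inE => /orP[] /eqP -> //.
by rewrite (invol_involutive k) setUC.
Qed.

Lemma edge_nonempty e : exists h, h \in edge_halves e.
Proof.
by case: e => E /= /imsetP[k _ ->]; exists k; rewrite !inE eqxx.
Qed.

Lemma edge_sgn_inj e h k :
  h \in edge_halves e -> k \in edge_halves e -> sgn h = sgn k -> h = k.
Proof.
move/edge_of_mem => <-; rewrite !inE => /orP[] /eqP -> // sgnE.
by apply/eqP; rewrite eq_sym; apply: contraT => /sgn_invol; rewrite sgnE eqxx.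
Qed.

Lemma vertex_exists h : exists2 v, v \in vertices G & h \in v.
Proof.
have := cover_partition (vertices_partition G) => /setP/(_ h).
by rewrite inE => /bigcupP[v Gv hv]; exists v.
Qed.

Lemma vertex_unique v1 v2 h :
  v1 \in vertices G -> v2 \in vertices G -> h \in v1 -> h \in v2 -> v1 = v2.
Proof.
have /and3P[_ triv _] := vertices_partition G.
by move=> Gv1 Gv2 h1 h2; rewrite -(def_pblock triv Gv1 h1) (def_pblock triv Gv2 h2).
Qed.

Lemma is_sourceP e v :
  is_source e v <->
  v \in vertices G /\ exists h, h \in Out_v v /\ edge_of h = e.
Proof.
split.
  case/andP => Gv /exists_inP[h he /andP[hv hs]]; split=> //; exists h.
  by rewrite inE hv hs (edge_of_mem he).
case=> Gv [h []]; rewrite inE => hP <-; rewrite /is_source Gv.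
by apply/exists_inP; exists h => //; apply: mem_edge_of.
Qed.

Lemma is_target_edge_of v h :
  v \in vertices G -> h \in In_v v -> is_target (edge_of h) v.
Proof.
rewrite inE => Gv hP; rewrite /is_target Gv.
by apply/exists_inP; exists h => //; apply: mem_edge_of.
Qed.

Lemma target_unique e v1 v2 : is_target e v1 -> is_target e v2 -> v1 = v2.
Proof.
move=> /andP[Gv1 /exists_inP[h he /andP[hv hs]]].
move=> /andP[Gv2 /exists_inP[k ke /andP[kv ks]]].
apply: vertex_unique hv _ => //.
by rewrite (edge_sgn_inj he ke) // hs ks.
Qed.

Lemma loop_virtual e v : is_source e v -> is_target e v -> is_virtual e.
Proof.
move=> /andP[Gv /exists_inP[h he /andP[hv hs]]].
move=> /andP[_ /exists_inP[k ke /andP[kv ks]]].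
have neq_kh : k != h by apply: contraNneq hs => <-.
have kE : k = invol h.
  by move: ke; rewrite -(edge_of_mem he) !inE (negPf neq_kh) => /eqP.
rewrite kE in neq_kh kv; rewrite /is_virtual -(edge_of_mem he) /=.
rewrite cards2 (eq_sym h) neq_kh /= -(virtual_vertex Gv neq_kh) //.
by rewrite subUset !sub1set hv.
Qed.

Lemma leads_toP e1 e2 :
  reflect (leads_to e1 e2) (connect (@consecutive G) e1 e2).
Proof.
by apply: (iffP connectP) => -[s ? ?]; exists s.
Qed.

End Edges.

(** * Planar structures *)

Section Planar.
Variables (G : oriented_graph) (prec : rel (edge G)).
Hypothesis prec_planar : planar_structure prec.
Implicit Types a b e : edge G.

Local Notation "e ~> e'" := (connect (@consecutive G) e e') (at level 70).

Lemma prec_trans : transitive prec.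
Proof.
by case: (planar_linear prec_planar) => _ tr _ b a c; apply: tr; rewrite inE.
Qed.

Lemma prec_asym a b : prec a b -> prec b a -> False.
Proof.
move=> ab ba; have := prec_trans ab ba.
by case: (planar_linear prec_planar) => irr _ _; rewrite irr ?inE.
Qed.

Lemma prec_neq a b : prec a b -> a != b.
Proof. by move=> ab; apply/eqP => E; subst b; apply: (prec_asym ab). Qed.

Lemma prec_total a b : a != b -> prec a b || prec b a.
Proof. by case: (planar_linear prec_planar) => _ _; apply; rewrite inE. Qed.

Lemma connect_prec a b : a != b -> a ~> b -> prec a b.
Proof. by move=> nab /leads_toP; apply: planar_P1. Qed.

Lemma connect_antisym : antisymmetric (connect (@consecutive G)).
Proof.
move=> a b /andP[ab ba]; apply/eqP; apply: contraT => nab.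
case: (prec_asym (connect_prec nab ab)); apply: connect_prec ba.
by rewrite eq_sym.
Qed.

(** If [b] came before [a], then [e1] would lie between [b] and [e2], and
    (P_2) applied to [b ~> e2] would yield [b ~> e1] or [e1 ~> e2], the latter
    giving [a ~> e2]. *)
Lemma prec_separated_ancestors a b e1 e2 :
  a ~> e1 -> b ~> e2 -> ~~ (a ~> e2) -> ~~ (b ~> e1) ->
  prec e1 e2 -> prec a b.
Proof.
move=> ae1 be2 nae2 nbe1 e12.
have neq_ab : a != b by apply: contraNneq nae2 => ->.
case/orP: (prec_total neq_ab) => // ba.
have be1 : prec b e1.
  have [<- //|neq] := eqVneq a e1.
  exact: prec_trans ba (connect_prec neq ae1).
case: (planar_P2 prec_planar (elimT (leads_toP _ _) be2) be1 e12) => /leads_toP.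
  by move=> e1e2; rewrite (connect_trans ae1 e1e2) in nae2.
by move=> b1; rewrite b1 in nbe1.
Qed.

(** A highest ancestor is an input edge: otherwise it has a source, through
    which some edge enters, and that edge lies strictly higher unless it is the
    same edge; but an edge running from a vertex to itself is virtual, and
    virtual edges are inputs as well. *)
Lemma input_ancestor e :
  directed G -> exists2 i, i \in In_G G & edge_of i ~> e.
Proof.
move=> dirG.
have [|b a c ab bc|a b||a ae max_a] :=
  @exists_maximal _ (fun a b => b ~> a) (fun a => a ~> e) e.
- exact: connect0.
- exact: connect_trans bc ab.
- by rewrite andbC; apply: connect_antisym.
- exact: connect0.
suff [i iI ia] : exists2 i, i \in In_G G & edge_of i = a.
  by exists i; rewrite ?ia.
have [|no_out] := boolP [exists h in edge_halves a, ~~ sgn h].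
  case/exists_inP => h ha hs; have [v Gv hv] := vertex_exists h.
  have [/set0Pn[k kv] _] := dirG v Gv.
  have av : is_source a v.
    by apply/is_sourceP; split=> //; exists h; rewrite (edge_of_mem ha) inE hv.
  have kt : is_target (edge_of k) v by apply: is_target_edge_of.
  have ka : edge_of k ~> a.
    by apply: connect1; apply/existsP; exists v; rewrite kt.
  have kE : edge_of k = a by apply: max_a => //; apply: connect_trans ka ae.
  rewrite kE in kt; exists k => //; move: kv; rewrite !inE => /andP[_ ->].
  by rewrite /leg kE (loop_virtual av kt) orbT.
have pos h : h \in edge_halves a -> sgn h.
  by move=> ha; apply: contraNT no_out => hs; apply/exists_inP; exists h.
have [h ha] := edge_nonempty a.
have ha' : invol h \in edge_halves a.
  by rewrite -(edge_of_mem ha) !inE eqxx orbT.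
exists h; last exact: edge_of_mem ha.
rewrite inE /leg (pos h ha) andbT (edge_sgn_inj ha' ha) ?eqxx //.
by rewrite !pos.
Qed.

(** The half-edges of separated ancestors can be taken both among the inputs
    of the graph or both among the outputs of one vertex, so that a compatible
    order has no choice on their edges. *)
Lemma separated_ancestors e1 e2 :
  directed G -> ~~ (e1 ~> e2) -> ~~ (e2 ~> e1) ->
  exists o1 o2 : half_edge G,
    [/\ edge_of o1 ~> e1, edge_of o2 ~> e2,
        ~~ (edge_of o1 ~> e2) & ~~ (edge_of o2 ~> e1)] /\
    ((o1 \in In_G G /\ o2 \in In_G G) \/
     (exists v, [/\ v \in vertices G, o1 \in Out_v v & o2 \in Out_v v])).
Proof.
move=> dirG n12 n21; pose common x := (x ~> e1) && (x ~> e2).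
have [/existsP[x0 common0]|no_common] := boolP [exists x, common x]; last first.
  have [i1 I1 i1e1] := input_ancestor e1 dirG.
  have [i2 I2 i2e2] := input_ancestor e2 dirG.
  exists i1, i2; split; last by left.
  split=> //; apply: contra no_common => ie; apply/existsP.
    by exists (edge_of i1); rewrite /common i1e1.
  by exists (edge_of i2); rewrite /common i2e2 andbT.
have [||||x /andP[x1 x2] max_x] :=
  @exists_maximal _ (connect (@consecutive G)) common x0.
- exact: connect0.
- exact: connect_trans.
- exact: connect_antisym.
- exact: common0.
have nx1 : x != e1 by apply: contraNneq n12 => <-.
have nx2 : x != e2 by apply: contraNneq n21 => <-.
have [a1 [xa1 na1 a1e1]] := connect_first_step x1 nx1.
have [a2 [xa2 na2 a2e2]] := connect_first_step x2 nx2.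
have /existsP[v /andP[xv /is_sourceP[Gv [o1 [o1v o1E]]]]] := xa1.
have /existsP[w /andP[xw /is_sourceP[_ [o2 [o2w o2E]]]]] := xa2.
rewrite (target_unique xw xv) in o2w.
exists o1, o2; rewrite o1E o2E; split; last by right; exists v.
split=> //.
  apply: contra na1 => a1e2; apply/eqP/max_x; last exact: connect1.
  by rewrite /common a1e1.
apply: contra na2 => a2e1; apply/eqP/max_x; last exact: connect1.
by rewrite /common a2e1.
Qed.

End Planar.

(** * Uniqueness *)

Lemma compatible_planar_sub (G : oriented_graph) (pol : polarization G)
    (anc : anchoring G) (prec1 prec2 : rel (edge G)) :
  directed G ->
  planar_structure prec1 -> compatible pol anc prec1 ->
  planar_structure prec2 -> compatible pol anc prec2 ->
  forall e1 e2 : edge G, prec1 e1 e2 -> prec2 e1 e2.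
Proof.
move=> dirG pl1 c1 pl2 c2 e1 e2 lt12.
have neq : e1 != e2 := prec_neq pl1 lt12.
have [/(connect_prec pl2 neq) //|n12] := boolP (connect (@consecutive G) e1 e2).
have [e21|n21] := boolP (connect (@consecutive G) e2 e1).
  have lt21 : prec1 e2 e1 by apply: connect_prec e21; rewrite // eq_sym.
  by case: (prec_asym pl1 lt12 lt21).
have [o1 [o2 [[s1 s2 ns1 ns2] prescribed]]] := separated_ancestors pl1 dirG n12 n21.
have lt1 : prec1 (edge_of o1) (edge_of o2).
  exact (prec_separated_ancestors pl1 s1 s2 ns1 ns2 lt12).
have lt2 : prec2 (edge_of o1) (edge_of o2).
  case: prescribed => [[I1 I2]|[v [Gv O1 O2]]].
    by apply/(compatible_In c2 I1 I2)/(compatible_In c1 I1 I2).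
  by apply/(compatible_out c2 Gv O1 O2)/(compatible_out c1 Gv O1 O2).
case/orP: (prec_total pl2 neq) => // gt2.
case: (prec_asym pl2 lt2).
exact (prec_separated_ancestors pl2 s2 s1 ns2 ns1 gt2).
Qed.

Theorem proposition3p2p8 (G : oriented_graph) (hG : progressive G)
    (pol : polarization G) (anc : anchoring G) (prec1 prec2 : rel (edge G)) :
  planar_structure prec1 -> compatible pol anc prec1 ->
  planar_structure prec2 -> compatible pol anc prec2 ->
  forall e1 e2 : edge G, prec1 e1 e2 <-> prec2 e1 e2.
Proof.
case: hG => dirG _ pl1 c1 pl2 c2 e1 e2.
by split; apply: (@compatible_planar_sub G pol anc).
Qed.
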